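(* For any subspaces $V,W\subset X$, with the full Grassmannians $G(V)$ and $G(W)$ regarded as subsets of $\mathbb{P}(\Lambda X)$ with the Fubini-Study distance, the directed Hausdorff distance from $G(V)$ to $G(W)$ is $h(G(V),G(W))=\Theta_{V,W}$.
   Context: $X$ is an $n$-dimensional vector space over $\mathbb{R}$ (real case) or $\mathbb{C}$ (complex case) with an inner product $\langle\cdot,\cdot\rangle$ (Hermitian in the complex case, conjugate-linear in the left entry). Subspaces and dimensions are over the same field. Principal angles: for nonzero subspaces $V,W\subset X$, with $p=\dim V$, $q=\dim W$, $m=\min\{p,q\}$, there are orthonormal bases $(e_1,\dots,e_p)$ of $V$ and $(f_1,\dots,f_q)$ of $W$ and uniquely determined numbers $0\le\theta_1\le\dots\le\theta_m\le\frac{\pi}{2}$ (the principal angles) such that $\langle e_i,f_j\rangle=\delta_{ij}\cos\theta_i$ (equal to $0$ whenever $i\neq j$). Grassmann angle: for nonzero subspaces $V,W\subset X$ with principal angles $\theta_1,\dots,\theta_m$, the Grassmann angle $\Theta_{V,W}\in[0,\frac{\pi}{2}]$ of $V$ with $W$ is $\Theta_{V,W}=\arccos(\cos\theta_1\cdots\cos\theta_m)$ if $\dim V\le\dim W$, and $\Theta_{V,W}=\frac{\pi}{2}$ if $\dim V>\dim W$. Also $\Theta_{\{0\},\{0\}}=\Theta_{\{0\},V}=0$ and $\Theta_{V,\{0\}}=\frac{\pi}{2}$ for $V\ne\{0\}$. Grassmann algebra: $\Lambda X=\bigoplus_p\Lambda^pX$ has the inner product determined by $\langle v_1\wedge\dots\wedge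 v_p,w_1\wedge\dots\wedge w_p\rangle=\det(\langle v_i,w_j\rangle)$, with distinct $\Lambda^pX$'s orthogonal, and $\langle\nu,\omega\rangle=\bar\nu\omega$ for scalars $\nu,\omega\in\Lambda^0X$. The full Grassmannian $G(V)$ of a subspace $V$ is the set of all subspaces of $V$ (of all dimensions $0,\dots,\dim V$), embedded in $\mathbb{P}(\Lambda X)$ by mapping each $k$-dimensional subspace $U\subset V$ to the line $\Lambda^kU$. The Fubini-Study distance on $\mathbb{P}(\Lambda X)$ is $d_{FS}(\operatorname{span}(v),\operatorname{span}(w))=\arccos\frac{|\langle v,w\rangle|}{\|v\|\|w\|}$. For non-empty compact sets $S,T$ in a metric space $(M,d)$, the directed Hausdorff distance from $S$ to $T$ is $h(S,T)=\max_{s\in S}d(s,T)$, where $d(s,T)=\min_{t\in T}d(s,t)$. *)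

(* Defs.v *)
From mathcomp Require Import all_boot all_order all_algebra.
From mathcomp Require Import all_classical all_reals all_analysis.
From mathcomp Require Import complex.

Set Implicit Arguments.
Unset Strict Implicit.
Unset Printing Implicit Defensive.

Import Order.TTheory GRing.Theory Num.Theory.
Local Open Scope ring_scope.

Variant ground := RealCase | ComplexCase.

Definition ground_field (R : realType) (k : ground) : numFieldType :=
  match k with RealCase => R | ComplexCase => R[i] end.

Definition sconj (R : realType) (k : ground) :
    {rmorphism ground_field R k -> ground_field R k} :=
  match k with RealCase => idfun | ComplexCase => @Num.conj R[i] end.

Definition of_real (R : realType) (k : ground) : R -> ground_field R k :=
  match k with RealCase => idfun | ComplexCase => real_complex R end.

(* The real part; it is only applied to scalars that are real. *)
Definition to_real (R : realType) (k : ground) : ground_field R k -> R :=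
  match k with RealCase => idfun | ComplexCase => @complex.Re R end.

Arguments sconj {R k}.
Arguments of_real {R k} _.
Arguments to_real {R k} _.

(* A form [ip : {dot X for sconj}] of the library is linear in its left entry
   and conjugate-linear in its right one, whereas the inner product used here
   is conjugate-linear in its left entry; hence the swap. *)
Definition inner (R : realType) (k : ground) (X : vectType (ground_field R k))
    (ip : {dot X for sconj}) (v w : X) : ground_field R k := ip w v.

Section PrincipalAngles.
Variables (R : realType) (k : ground) (X : vectType (ground_field R k)).
Variable ip : {dot X for sconj}.
Implicit Types V W : {vspace X}.

Definition is_principal_angles V W (theta : seq R) : Prop :=
  [/\ size theta = minn (\dim V) (\dim W),
      sorted <=%R theta,
      (forall t, t \in theta -> 0 <= t <= pi / 2) &
      exists e f : seq X,
        [/\ basis_of V e && orthonormal ip e,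
            basis_of W f && orthonormal ip f &
            forall i j : nat, (i < \dim V)%N -> (j < \dim W)%N ->
              inner ip e`_i f`_j =
              if i == j then of_real (cos theta`_i) else 0]].

(* Such a list exists and is unique for all nonzero V and W. *)
Definition principal_angles V W : seq R :=
  xget [::] [set theta | is_principal_angles V W theta]%classic.

Definition grassmann_angle V W : R :=
  if \dim V == 0%N then 0
  else if \dim W == 0%N then pi / 2
  else if (\dim V <= \dim W)%N then
    acos (\prod_(t <- principal_angles V W) cos t)
  else pi / 2.

End PrincipalAngles.

(* The Grassmann algebra of X in coordinates: with (e_i) the basis
   [vbasis {:X}], the component [a S] is the coefficient in [a] of the blade
   e_S, the exterior product of the e_i, i in S, taken in increasing order. *)
Section GrassmannAlgebra.
Variables (R : realType) (k : ground) (X : vectType (ground_field R k)).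
Local Notation I := 'I_(\dim {:X}).

Definition extalg : vectType (ground_field R k) := {ffun {set I} -> (ground_field R k)^o}.

(* e_S ^ e_T = (-1) ^ (inversions S T) e_(S u T) for disjoint S and T. *)
Definition inversions (S T : {set I}) : nat :=
  #|[set p : I * I | [&& p.1 \in S, p.2 \in T & (p.2 < p.1)%N]]|.

Definition extmul (a b : extalg) : extalg :=
  [ffun U : {set I} => \sum_(S : {set I} | S \subset U)
     (-1) ^+ inversions S (U :\: S) * (a S * b (U :\: S))].

Definition extone : extalg := [ffun S : {set I} => (S == finset.set0)%:R].

Definition extvec (v : X) : extalg :=
  [ffun S : {set I} =>
     \sum_(i < \dim {:X}) coord (vbasis {:X}) i v * (S == [set i])%:R].

Definition wedge (s : seq X) : extalg :=
  foldr (fun v a => extmul (extvec v) a) extone s.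

(* The p-th exterior power of U, as a subspace of the Grassmann algebra: by
   multilinearity it is spanned by the products of p vectors of a basis. *)
Definition extpow (p : nat) (U : {vspace X}) : {vspace extalg} :=
  <<[seq wedge [seq (vbasis U)`_i | i : 'I_(\dim U) <- t]
      | t : p.-tuple 'I_(\dim U)]>>%VS.

Variable ip : {dot X for sconj}.

(* The inner product of v_1 ^ ... ^ v_p and w_1 ^ ... ^ w_q. *)
Definition gram (v w : seq X) : ground_field R k :=
  if size v == size w
  then \det (\matrix_(i < size v, j < size v) inner ip v`_i w`_j) else 0.

Definition blade (S : {set I}) : seq X := [seq (vbasis {:X})`_i | i : I <- enum S].

(* The sesquilinear extension of [gram] from the blades e_S; for S empty it
   gives conj(nu) * omega on scalars. *)
Definition ext_inner (a b : extalg) : ground_field R k :=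
  \sum_(S : {set I}) \sum_(T : {set I})
    sconj (a S) * b T * gram (blade S) (blade T).

Definition ext_norm (a : extalg) : R := Num.sqrt (to_real (ext_inner a a)).

End GrassmannAlgebra.

Definition projective (F : fieldType) (L : vectType F) : Type :=
  {l : {vspace L} | \dim l == 1%N}.

Section Grassmannian.
Variables (R : realType) (k : ground) (X : vectType (ground_field R k)).

Definition full_grassmannian (V : {vspace X}) : set (projective (extalg X)) :=
  [set l | exists2 U : {vspace X}, (U <= V)%VS & val l = extpow (\dim U) U]%classic.

(* [vpick l] is a nonzero vector of the line l; the value does not depend on
   which one is taken. *)
Definition fubini_study (ip : {dot X for sconj}) (l m : projective (extalg X)) : R :=
  let v := vpick (val l) in let w := vpick (val m) in
  acos (to_real `|ext_inner ip v w| / (ext_norm ip v * ext_norm ip w)).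

End Grassmannian.

Section Hausdorff.
Variables (R : realType) (M : Type) (d : M -> M -> R).
Implicit Types (A : set R) (S T : set M).

Definition is_max A x : Prop := A x /\ ubound A x.
Definition is_min A x : Prop := A x /\ lbound A x.

(* r = d(s, T) *)
Definition is_dist_to s T r : Prop := is_min [set d s t | t in T]%classic r.

(* h = h(S, T); that the minima and the maximum are attained is part of it. *)
Definition is_directed_hausdorff S T h : Prop :=
  (forall s, S s -> exists r, is_dist_to s T r) /\
  is_max [set r | exists2 s, S s & is_dist_to s T r]%classic h.

End Hausdorff.

(* Main.v *)
Require Import Defs.
From mathcomp Require Import all_boot all_order all_algebra.
From mathcomp Require Import all_classical all_reals all_analysis.
From mathcomp Require Import complex ring.

Set Implicit Arguments.
Unset Strict Implicit.
Unset Printing Implicit Defensive.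

Import Order.TTheory GRing.Theory Num.Theory.
Local Open Scope ring_scope.

(** The distance between the lines of two subspaces U and U' is governed by a
    Gram determinant: in orthonormal bases e of U and e' of U' it is
    arccos |det <e_i, e'_j>|  ([fubini_studyE]), and it is pi/2 as soon as the
    dimensions differ.  This rests on the identity
    <v_1 ^ ... ^ v_p, w_1 ^ ... ^ w_q> = gram v w  ([ext_inner_wedge]) for
    arbitrary vectors: both sides are alternating and multilinear in v and in w,
    and they agree on the basis blades by definition of the inner product.

    Let U have dimension p at most that of W, with principal angles theta_i and
    principal bases e of U and f of W.  The projection of e_i on W is
    cos theta_i f_i, so the scalar products of e_i with vectors of W are those
    of f_i multiplied by cos theta_i.  Pulling these factors out of the rows of
    a determinant ([principal_gram]) gives, for an orthonormal basis g of a
    subspace of W,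
      |gram e g| = (prod_i cos theta_i) |gram (f_1, ..., f_p) g|,
    and the last factor is at most 1 by Hadamard's inequality
    ([gram_Hadamard]), with equality for g = (f_1, ..., f_p).  Hence the
    distance from the line of U to G(W) is the Grassmann angle of U with W
    ([dist_to_grassmannian]); for dim U > dim W both are pi/2 since no subspace
    of W has the dimension of U.

    It remains to see that the angle of U with W grows with U
    ([grassmann_angle_mono]), so that the maximum over G(V) is attained at the
    line of V.  For U in V and dim V <= dim W, complete the principal basis e
    of U by r to an orthonormal basis of V, and let g be the first dim V vectors
    of the principal basis of W relative to V.  The product of the cosines of
    (V, W) is |gram (e, r) g|, since changing the orthonormal basis of V only
    contributes a factor of modulus 1.  By the same factorization it is
    prod cos theta_i(U, W) times |gram (f_1, ..., f_p, r) g|, and the rows of that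
    last determinant still come from unit vectors, so Hadamard applies again.

    Principal angles exist ([principal_angles_exist]) because the form
    (x, y) |-> <P x, y>, with P the projection onto W, can be diagonalized in an
    orthonormal basis of V ([codiagonal_basis]). *)

(** * The scalar field *)

Section Scalars.
Variables (R : realType) (k : ground).
Local Notation F := (ground_field R k).
Implicit Types x y : F.

Lemma sconjK : involutive (@sconj R k).
Proof. by case: k => x //=; exact: conjCK. Qed.

Lemma sqr_norm_sconj x : `|x| ^+ 2 = x * sconj x.
Proof.
case: k x => x /=; first by rewrite -normrX ger0_norm ?sqr_ge0.
exact: normCK.
Qed.

Lemma sconj_ge0 x : 0 <= x -> sconj x = x.
Proof. by case: k x => //= x x0; apply/CrealP/ger0_real. Qed.

Lemma of_realK : cancel (@of_real R k) to_real.
Proof. by case: k. Qed.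

Lemma to_realK x : 0 <= x -> of_real (to_real x) = x.
Proof. by case: k x => //= x x0; apply/RRe_real/ger0_real. Qed.

Lemma ler_of_real : {mono @of_real R k : a b / a <= b}.
Proof. by case: k => //= a b; rewrite lecR. Qed.

Lemma of_real0 : of_real 0 = 0 :> F. Proof. by case: k. Qed.
Lemma of_real1 : of_real 1 = 1 :> F. Proof. by case: k. Qed.

Lemma of_realM (a b : R) : of_real (a * b) = of_real a * of_real b :> F.
Proof. by case: k => //=; rewrite rmorphM. Qed.

Lemma of_real_prod I (r : seq I) (f : I -> R) :
  of_real (\prod_(i <- r) f i) = \prod_(i <- r) of_real (f i) :> F.
Proof.
by elim: r => [|i r IH]; rewrite ?big_nil ?of_real1 // !big_cons of_realM IH.
Qed.

Lemma sqrt_ground x : 0 <= x -> exists2 s : R, 0 <= s & of_real s ^+ 2 = x.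
Proof.
move=> x0; have r0 : 0 <= to_real x.
  by rewrite -ler_of_real of_real0 to_realK.
exists (Num.sqrt (to_real x)); first exact: sqrtr_ge0.
by rewrite expr2 -of_realM -expr2 sqr_sqrtr ?to_realK.
Qed.

Lemma to_real_normM x y : to_real `|x * y| = to_real `|x| * to_real `|y|.
Proof. by apply: (can_inj of_realK); rewrite of_realM !to_realK ?normrM. Qed.

Lemma to_real_norm_ge0 x : 0 <= to_real `|x|.
Proof. by rewrite -ler_of_real of_real0 to_realK. Qed.

Lemma norm_sconj x : `|sconj x| = `|x|.
Proof. by apply/eqP; rewrite -(@eqrXn2 _ 2) // !sqr_norm_sconj sconjK mulrC. Qed.

(** Over the complex numbers any square matrix has an eigenvector.  A real
    symmetric matrix has a complex eigenvalue, which is real because the matrix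
    is Hermitian; a real root of the real characteristic polynomial then has a
    real eigenvector. *)
Lemma hermitian_eigenvector n (H : 'M[F]_n.+1) :
  (forall i j, H i j = sconj (H j i)) ->
  exists a (v : 'rV[F]_n.+1), v != 0 /\ v *m H = a *: v.
Proof.
case: k H => /= H HH; last first.
  have [a ra] : exists a, root (char_poly H) a.
    by apply/closed_rootP; rewrite size_char_poly.
  move: ra; rewrite -eigenvalue_root_char => /eigenvalueP[v vH v0].
  by exists a, v.
pose toC : {rmorphism R -> R[i]} := real_complex R.
have [a ra] : exists a, root (char_poly (map_mx toC H)) a.
  by apply/closed_rootP; rewrite size_char_poly.
have /eigenvalueP[v vH v0] : eigenvalue (map_mx toC H) a.
  by rewrite eigenvalue_root_char.
pose C : numClosedFieldType := R[i].
pose star m p (A : matrix C m p) : matrix C p m := map_mx (@Num.conj C) A^T.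
have starK m p (A : 'M[C]_(m, p)) : star _ _ (star _ _ A) = A.
  by apply/matrixP => i j; rewrite !mxE conjCK.
have starM m p r (A : 'M[C]_(m, p)) (B : 'M[C]_(p, r)) :
    star _ _ (A *m B) = star _ _ B *m star _ _ A.
  by rewrite /star trmx_mul map_mxM.
have starH : star _ _ (map_mx toC H) = map_mx toC H.
  apply/matrixP => i j; rewrite !mxE HH.
  by apply/CrealP/complex_realP; exists (H i j).
pose q := (v *m map_mx toC H *m star _ _ v) 0 0.
pose N := (v *m star _ _ v) 0 0.
(* With v H = a v, the scalar q = v H v* is a |v|^2, and it is its own
   conjugate; so a = q / |v|^2 is real. *)
have qE : q = a * N by rewrite /q vH -scalemxAl mxE.
have qr : Num.conj q = q.
  transitivity (star _ _ (v *m map_mx toC H *m star _ _ v) 0 0).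
    by rewrite [RHS]mxE [X in _ = Num.conj X]mxE.
  by rewrite !starM starK starH mulmxA.
have N0 : 0 < N.
  have [i vi] := rV0Pn v v0.
  rewrite /N mxE (bigD1 i) //= ltr_wpDr //.
    by apply: sumr_ge0 => j _; rewrite !mxE mul_conjC_ge0.
  by rewrite !mxE mul_conjC_gt0.
have ar : a \is Num.real.
  have -> : a = q / N by rewrite qE mulfK // gt_eqF.
  by rewrite realM ?realV ?(gtr0_real N0) //; apply/CrealP.
have aE : a = toC (complex.Re a) by rewrite /toC /= RRe_real.
have : root (char_poly H) (complex.Re a).
  by move: ra; rewrite aE -map_char_poly fmorph_root.
rewrite -eigenvalue_root_char => /eigenvalueP[w wH w0].
by exists (complex.Re a), w.
Qed.

End Scalars.

(** * Orthonormal families and orthogonal projections *)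

Section Orthonormal.
Variables (R : realType) (k : ground) (X : vectType (ground_field R k)).
Variable ip : {dot X for sconj}.
Local Notation F := (ground_field R k).
Implicit Types (u v w x y : X) (e f g s t : seq X) (U V W : {vspace X}).

Lemma dotC u v : ip u v = sconj (ip v u).
Proof. by rewrite hermC expr0 mul1r. Qed.

Lemma dot_eq0 u : (ip u u == 0) = (u == 0).
Proof.
have [->|u0] := eqVneq u 0; first by rewrite linear0l eqxx.
by rewrite gt_eqF // neq0_dnorm_gt0.
Qed.

Lemma dot_ge0 u : 0 <= ip u u.
Proof.
have [->|u0] := eqVneq u 0; first by rewrite linear0l.
by rewrite ltW // neq0_dnorm_gt0.
Qed.

Lemma dotZ a u : ip (a *: u) (a *: u) = `|a| ^+ 2 * ip u u.
Proof. by rewrite linearZl_LR linearZr_LR /= mulrA -sqr_norm_sconj. Qed.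

Lemma normalize u : u != 0 -> exists2 a : F, a != 0 & ip (a *: u) (a *: u) = 1.
Proof.
move=> u0; have [s s0 sE] := sqrt_ground (dot_ge0 u).
have sn0 : of_real s != 0 :> F.
  apply/eqP => s_eq; move: sE; rewrite s_eq expr0n /= => /esym/eqP.
  by rewrite dot_eq0 (negPf u0).
exists (of_real s)^-1; first by rewrite invr_eq0.
by rewrite dotZ -sE normfV ger0_norm ?exprVn ?mulVf ?expf_neq0 // -of_real0 ler_of_real.
Qed.

Lemma pair_ortho_recE e :
  pair_ortho_rec ip e = pairwise (fun u v => ip u v == 0) e.
Proof. by elim: e => //= u e ->; rewrite andbT. Qed.

(** The characterization by positions is used to compute matrices of scalar
    products; [orthonormal_memP] below, by membership, shows that permuting an
    orthonormal list keeps it orthonormal. *)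
Lemma orthonormal_nthP e :
  reflect (forall i j, (i < size e)%N -> (j < size e)%N ->
             ip e`_i e`_j = (i == j)%:R) (orthonormal ip e).
Proof.
rewrite /orthonormal pair_ortho_recE; apply: (iffP andP).
  move=> [/(all_nthP 0)/= n1 /(pairwiseP 0) o] i j il jl.
  case: ltngtP => [ij|ij|->]; last by apply/eqP/n1.
    by apply/eqP/o.
  by rewrite dotC (eqP (o j i jl il ij)) rmorph0.
move=> H; split; first by apply/(all_nthP 0) => i il /=; rewrite H ?eqxx.
apply/(pairwiseP 0) => i j il jl ij; rewrite H //.
by rewrite (ltn_eqF ij).
Qed.

Lemma dot_span e (c : nat -> F) j : orthonormal ip e -> (j < size e)%N ->
  ip (\sum_(i < size e) c i *: e`_i) e`_j = c j.
Proof.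
move=> /orthonormal_nthP He jl; rewrite linear_sumlz (bigD1 (Ordinal jl)) //=.
rewrite linearZl_LR /= He // eqxx mulr1 big1 ?addr0 // => i ij.
by rewrite linearZl_LR /= He // (_ : _ == _ = false) ?mulr0 //; apply/negbTE.
Qed.

Lemma orthonormal_free e : orthonormal ip e -> free e.
Proof.
move=> He; rewrite -[e]in_tupleE; apply/freeP => c c0 i.
(* [dot_span] takes coefficients indexed by nat, so c is extended by 0. *)
pose c' j := if insub j is Some i then c i else 0.
have := dot_span c' He (ltn_ord i); rewrite [in RHS]/c' valK => <-.
rewrite (eq_bigr (fun j => c j *: (in_tuple e)`_j)) ?c0 ?linear0l // => j _.
by rewrite /c' valK.
Qed.

(** The orthogonal projection onto the span of e, when e is orthonormal. *)
Definition proj e x := \sum_(i < size e) ip x e`_i *: e`_i.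

Lemma proj_mem e x : proj e x \in <<e>>%VS.
Proof. by apply: memv_suml => i _; rewrite memvZ // memv_span // mem_nth. Qed.

Lemma dot_proj_nth e x i : orthonormal ip e -> (i < size e)%N ->
  ip (proj e x) e`_i = ip x e`_i.
Proof. by move=> He il; rewrite (dot_span (fun i => ip x e`_i)). Qed.

Lemma orthov_span e x : (forall i, (i < size e)%N -> ip x e`_i = 0) ->
  forall y, y \in <<e>>%VS -> ip x y = 0.
Proof.
move=> H y; rewrite -[e]in_tupleE => /coord_span ->; rewrite linear_sumr big1 // => i _.
by rewrite linearZr_LR /= H // mulr0.
Qed.

Lemma dot_proj e x y : orthonormal ip e -> y \in <<e>>%VS ->
  ip (proj e x) y = ip x y.
Proof.
move=> He ye; apply/eqP; rewrite -subr_eq0 -linearBl; apply/eqP.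
by apply: orthov_span ye => i il; rewrite linearBl /= dot_proj_nth ?subrr.
Qed.

Lemma proj_id e x : orthonormal ip e -> x \in <<e>>%VS -> proj e x = x.
Proof.
move=> He xe; apply/eqP; rewrite -subr_eq0 -dot_eq0 linearBl /= dot_proj ?subrr //.
by rewrite memvB // proj_mem.
Qed.

Lemma dot_proj_proj e x y : orthonormal ip e ->
  ip (proj e x) (proj e y) = ip x (proj e y).
Proof. by move=> He; rewrite dot_proj // proj_mem. Qed.

Lemma proj_contract e x : orthonormal ip e -> ip (proj e x) (proj e x) <= ip x x.
Proof.
move=> He; rewrite -{3 4}(subrK (proj e x) x) hnormDd.
  by rewrite lerDr dot_ge0.
by rewrite linearBl /= dot_proj_proj // subrr.
Qed.

Lemma orthonormal_cons x e : orthonormal ip (x :: e) =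
  [&& ip x x == 1, orthonormal ip e & all (fun u => ip x u == 0) e].
Proof.
rewrite /orthonormal /= andbT -!andbA; congr (_ && _).
by rewrite [RHS]andbA [RHS]andbC [LHS]andbCA.
Qed.

Lemma orthonormal_memP e :
  reflect (uniq e /\ {in e &, forall u v, ip u v = (u == v)%:R}) (orthonormal ip e).
Proof.
apply: (iffP idP) => [He|[ue He]].
  have ue := free_uniq (orthonormal_free He); split=> // u v.
  move=> /(nthP 0)[i il <-] /(nthP 0)[j jl <-].
  by rewrite nth_uniq //; apply/(orthonormal_nthP _ He).
apply/orthonormal_nthP => i j il jl.
by rewrite He ?mem_nth // nth_uniq.
Qed.

Lemma proj_adj f x y : orthonormal ip f -> ip (proj f x) y = ip x (proj f y).
Proof.
move=> Hf; rewrite dotC -(dot_proj y Hf) ?proj_mem // -dotC.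
by rewrite dot_proj_proj.
Qed.

Lemma orthonormal_rcons e x : orthonormal ip (rcons e x) =
  [&& orthonormal ip e, ip x x == 1 & all (fun u => ip u x == 0) e].
Proof.
rewrite /orthonormal !pair_ortho_recE all_rcons pairwise_rcons /=.
by rewrite -!andbA; do !bool_congr.
Qed.

(** Gram-Schmidt: as long as e does not span V, some vector of V minus its
    projection is a nonzero vector of V orthogonal to e. *)
Lemma extend_orthonormal e V : orthonormal ip e -> (<<e>> <= V)%VS ->
  exists f, orthonormal ip (e ++ f) /\ <<e ++ f>>%VS = V.
Proof.
have [n] := ubnP (\dim V - size e); elim: n e => // n IH e len He eV.
have [eqV|neV] := eqVneq <<e>>%VS V; first by exists [::]; rewrite cats0.
have [v vV ve] : exists2 v, v \in V & v \notin <<e>>%VS.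
  by apply/subvPn; apply: contra neV => Ve; rewrite eqEsubv eV.
have z0 : v - proj e v != 0.
  by rewrite subr_eq0; apply: contra ve => /eqP ->; exact: proj_mem.
have [a a0 na] := normalize z0.
have He' : orthonormal ip (rcons e (a *: (v - proj e v))).
  rewrite orthonormal_rcons He na eqxx /=; apply/allP => u ue.
  rewrite herm_eq0C linearZl_LR /= linearBl /= dot_proj ?memv_span //.
  by rewrite subrr mulr0.
have [|//|f [Hf fV]] := IH (rcons e (a *: (v - proj e v))) _ He'.
- rewrite size_rcons.
  have: (\dim <<e>> < \dim V)%N.
    rewrite ltn_neqAle dimvS // andbT; apply: contra neV => /eqP d.
    by rewrite eqEdim eV d leqnn.
  rewrite (eqP (orthonormal_free He)) -subn_gt0 subnS.
  by case: (_ - _)%N len.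
- rewrite -cats1 span_cat subv_add eV span_seq1 /= -memvE memvZ // memvB //.
  by apply: (subvP eV); exact: proj_mem.
by exists (a *: (v - proj e v) :: f); rewrite -cat_rcons.
Qed.

Lemma orthonormal_basis_exists V : exists e, basis_of V e /\ orthonormal ip e.
Proof.
have [|e [He eV]] := @extend_orthonormal [::] V isT; first by rewrite span_nil sub0v.
by exists e; split=> //; rewrite basisEdim -eV subvv (eqP (orthonormal_free He)) leqnn.
Qed.

End Orthonormal.

(** * Gram determinants *)

Section Gram.
Variables (R : realType) (k : ground) (X : vectType (ground_field R k)).
Variable ip : {dot X for sconj}.
Local Notation F := (ground_field R k).
Implicit Types (u v w x y : X) (e f g s t : seq X) (U V W : {vspace X}).

Lemma gramE n s t : size s = n -> size t = n ->
  gram ip s t = \det (\matrix_(i < n, j < n) ip t`_j s`_i).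
Proof. by move=> <- st; rewrite /gram st eqxx. Qed.

Lemma gram_size s t : size s != size t -> gram ip s t = 0.
Proof. by rewrite /gram => /negPf ->. Qed.

Lemma gramC s t : gram ip s t = sconj (gram ip t s).
Proof.
have [st|st] := eqVneq (size t) (size s); last first.
  by rewrite !gram_size ?rmorph0 // eq_sym.
rewrite (gramE (erefl _) st) (gramE st (erefl _)) -det_map_mx -det_tr.
by congr (\det _); apply/matrixP => i j; rewrite !mxE dotC.
Qed.

(** Expanding the vectors of t in the orthonormal basis e writes the matrix of
    scalar products of s with t as a product of two such matrices.  Every
    change of basis below is an instance of this. *)
Lemma gram_mulr e s t : orthonormal ip e -> size s = size e -> size t = size e ->
  {subset t <= <<e>>%VS} -> gram ip s t = gram ip s e * gram ip e t.
Proof.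
move=> He se te tE; rewrite (gramE se te) (gramE se (erefl _)).
rewrite (gramE (erefl _) te) -det_mulmx; congr (\det _).
apply/matrixP => i j; rewrite !mxE -{1}(proj_id He (tE t`_j _)) ?mem_nth ?te //.
rewrite /proj linear_sumlz; apply: eq_bigr => l _.
by rewrite linearZl_LR /= !mxE mulrC.
Qed.

Lemma gram_orthonormal e : orthonormal ip e -> gram ip e e = 1.
Proof.
move=> /orthonormal_nthP He; rewrite (gramE (erefl _) (erefl _)) -[RHS](det1 _ (size e)).
by congr (\det _); apply/matrixP => i j; rewrite !mxE He // eq_sym.
Qed.

Lemma gram_span_norm1 e g : orthonormal ip e -> orthonormal ip g ->
  <<e>>%VS = <<g>>%VS -> `|gram ip e g| = 1.
Proof.
move=> He Hg eg.
have sz : size g = size e.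
  by rewrite -(eqP (orthonormal_free He)) eg (eqP (orthonormal_free Hg)).
have : `|gram ip e g| ^+ 2 = 1.
  rewrite sqr_norm_sconj -gramC -gram_mulr ?gram_orthonormal // => x.
  by rewrite -eg; exact: memv_span.
by move=> /eqP; rewrite sqrp_eq1 // => /eqP.
Qed.

Lemma gram_norm_span g e h : orthonormal ip e -> orthonormal ip h ->
  <<e>>%VS = <<h>>%VS -> size g = size e -> `|gram ip e g| = `|gram ip h g|.
Proof.
move=> He Hh eh sg.
have sz : size h = size e.
  by rewrite -(eqP (orthonormal_free He)) eh (eqP (orthonormal_free Hh)).
rewrite gramC (gram_mulr Hh) ?sz //; last by move=> x; rewrite -eh; exact: memv_span.
by rewrite norm_sconj normrM [X in _ * X]gram_span_norm1 // mulr1 gramC norm_sconj.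
Qed.

(** The coordinates of e in the basis s give a matrix N with
    (<e_i, s_l>) N = (<e_i, e_j>) = 1. *)
Lemma gram_basis_neq0 e s : orthonormal ip e -> free s -> <<e>>%VS = << s >>%VS ->
  gram ip e s != 0.
Proof.
move=> He fs es.
have sz : size s = size e.
  by rewrite -(eqP (orthonormal_free He)) es (eqP fs).
have ein (i : 'I_(size e)) : e`_i \in << s >>%VS.
  by rewrite -es memv_span // mem_nth.
pose N := \matrix_(l < size e, j < size e)
  coord (in_tuple s) (cast_ord (esym sz) l) e`_j.
suff : gram ip e s * \det N = 1.
  by apply: contra_eq_neq => ->; rewrite mul0r eq_sym oner_eq0.
rewrite -(gram_orthonormal He) (gramE (erefl _) sz) (gramE (erefl _) (erefl _)).
rewrite -det_mulmx; congr (\det _); apply/matrixP => i j; rewrite !mxE.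
have /coord_span -> : e`_j \in <<in_tuple s>>%VS by [].
rewrite linear_sumlz (reindex (cast_ord (esym sz))) /=; last first.
  by exists (cast_ord sz) => l _; apply: val_inj.
apply: eq_bigr => l _; rewrite !mxE linearZl_LR /= mulrC.
by congr (coord _ _ _ * _).
Qed.

Lemma gram_scale s s' t (c : nat -> F) : size s' = size s ->
  (forall i j, (i < size s)%N -> (j < size t)%N ->
     ip t`_j s`_i = c i * ip t`_j s'`_i) ->
  gram ip s t = (\prod_(i < size s) c i) * gram ip s' t.
Proof.
move=> ss H; have [st|st] := eqVneq (size t) (size s); last first.
  by rewrite eq_sym in st; rewrite !gram_size ?mulr0 // ss.
rewrite (gramE (erefl _) st) (gramE ss st).
have -> : \prod_(i < size s) c i = \det (diag_mx (\row_(i < size s) c i)).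
  by rewrite det_diag; apply: eq_bigr => i _; rewrite mxE.
rewrite -det_mulmx; congr (\det _); apply/matrixP => i j.
by rewrite mul_diag_mx !mxE H ?st.
Qed.

Lemma gram_cons_orth x y s t : {in t, forall z, ip z x = 0} ->
  gram ip (x :: s) (y :: t) = ip y x * gram ip s t.
Proof.
move=> H; have [st|st] := eqVneq (size t) (size s); last first.
  by rewrite eq_sym in st; rewrite !gram_size ?mulr0.
rewrite (@gramE (size s).+1) /= ?st // (gramE (erefl _) st).
rewrite (expand_det_row _ ord0) big_ord_recl big1 ?addr0 => [|j _]; last first.
  by rewrite mxE /= H ?mul0r // mem_nth // add0n st.
rewrite mxE /cofactor addn0 expr0 mul1r; congr (_ * \det _).
by apply/matrixP => i j; rewrite !mxE.
Qed.

Lemma dot_le1 x y : ip y y = 1 -> ip x x <= 1 -> `|ip y x| <= 1.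
Proof.
move=> y1 x1; have Hy : orthonormal ip [:: y] by rewrite /orthonormal /= y1 eqxx.
rewrite -(@expr_le1 _ 2) // (le_trans _ x1) //.
apply: le_trans (proj_contract x Hy).
rewrite /proj big_ord1 dotZ /= y1 mulr1 sqr_norm_sconj mulrC dotC sconjK.
by rewrite [ip x y]dotC -sqr_norm_sconj.
Qed.

(** Hadamard's inequality, by induction on the number of rows.  If the first
    vector x projects to 0 on the span of g, the first row vanishes.  Otherwise
    replace g, up to a factor of modulus 1, by an orthonormal basis of its span
    whose first vector h0 is the normalized projection of x: the first row is
    then (<x, h0>, 0, ..., 0), and |<x, h0>| <= 1 by Cauchy-Schwarz
    ([dot_le1]). *)
Lemma gram_Hadamard s g : orthonormal ip g -> {in s, forall x, ip x x <= 1} ->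
  `|gram ip s g| <= 1.
Proof.
elim: s g => [|x s IH] g Hg Hs.
  have [g0|g0] := eqVneq (size g) 0%N; last first.
    by rewrite gram_size ?normr0 ?ler01 // eq_sym.
  by rewrite (@gramE 0) // det_mx00 normr1.
have [sg|sg] := eqVneq (size g) (size s).+1; last first.
  by rewrite gram_size ?normr0 ?ler01 // eq_sym.
have [p0|p0] := eqVneq (proj ip g x) 0.
  rewrite (@gramE (size s).+1 (x :: s)) // (expand_det_row _ ord0).
  rewrite big1 ?normr0 ?ler01 // => j _.
  rewrite mxE /= dotC -(dot_proj_nth x Hg) ?sg // p0 linear0l rmorph0 mul0r //.
have [a a0 na] := normalize ip p0; set h0 := a *: _ in na.
have h0p z : z \in <<g>>%VS -> ip h0 z = a * ip x z.
  by move=> zg; rewrite linearZl_LR /= dot_proj.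
have Hh0 : orthonormal ip [:: h0] by rewrite /orthonormal /= na eqxx.
have h0g : h0 \in <<g>>%VS by rewrite memvZ // proj_mem.
have [|h [Hh hg]] := extend_orthonormal Hh0 (V := <<g>>%VS).
  by rewrite span_seq1 -memvE.
have sh : size (h0 :: h) = size g.
  by rewrite -(eqP (orthonormal_free Hg)) -hg (eqP (orthonormal_free Hh)).
rewrite (gram_mulr Hh) ?sh ?sg //; last by move=> z zg; rewrite hg memv_span.
rewrite normrM [X in _ * X](gram_span_norm1 Hh Hg hg) mulr1.
rewrite gram_cons_orth => [|z zh]; last first.
  have := h0p z; rewrite -hg memv_span ?inE ?zh ?orbT // => /(_ isT).
  have /(nthP 0)[i ih <-] := zh.
  have /orthonormal_nthP/(_ 0 i.+1)/= -> // := Hh.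
  by move=> /esym/eqP; rewrite mulf_eq0 (negPf a0) /= herm_eq0C => /eqP.
rewrite normrM mulr_ile1 ?normr_ge0 //; last first.
  apply: IH => [|z zs]; last by rewrite Hs // inE zs orbT.
  by move: Hh => /andP[/= /andP[_ ?] /andP[_ ?]]; apply/andP.
by apply: dot_le1 na (Hs _ _); rewrite inE eqxx.
Qed.

End Gram.

(** * Existence of principal angles *)

Section Acos.
Variable R : realType.
Implicit Types x y : R.

Lemma acos_anti x y : 0 <= x -> x <= y -> y <= 1 -> acos y <= acos x.
Proof.
move=> x0 xy y1.
have bnd (z : R) : 0 <= z -> z <= 1 -> -1 <= z <= 1.
  by move=> z0 ->; rewrite (le_trans _ z0) // lerN10.
have xb := bnd x x0 (le_trans xy y1); have yb := bnd y (le_trans x0 xy) y1.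
rewrite leNgt; apply/negP; rewrite -ltr_cos ?in_itv /= ?acos_ge0 ?acos_lepi //.
by rewrite !acosK ?in_itv //= ltNge xy.
Qed.

Lemma acos_pihalf x : 0 <= x -> x <= 1 -> 0 <= acos x <= pi / 2.
Proof. by move=> x0 x1; rewrite -acos0 -{1}acos1 !acos_anti. Qed.

End Acos.

Section PrincipalAnglesExist.
Variables (R : realType) (k : ground) (X : vectType (ground_field R k)).
Variable ip : {dot X for sconj}.
Local Notation F := (ground_field R k).
Implicit Types (u v w x y : X) (e f g s t : seq X) (U V W : {vspace X}).

(** The spectral theorem for the Hermitian form B(x, y) = <P x, y> on the span
    of g, with P the projection onto the span of f: an eigenvector e0 of the
    matrix of B satisfies B(e0, y) = a <e0, y>, so B(e0, y) = 0 for y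
    orthogonal to e0, and one recurses in the orthogonal complement of e0. *)
Lemma codiagonal_basis g f : orthonormal ip g -> orthonormal ip f ->
  exists e, [/\ orthonormal ip e, <<e>>%VS = <<g>>%VS &
    {in e &, forall u v, u != v -> ip (proj ip f u) v = 0}].
Proof.
move=> + Hf; have [n] := ubnP (size g); elim: n g => // n IH g.
case sg: (size g) => [|m] mn Hg; first by exists g; rewrite (size0nil sg).
pose H := \matrix_(i < m.+1, j < m.+1) ip g`_i (proj ip f g`_j).
have [|a [v [v0 vH]]] := @hermitian_eigenvector _ _ _ H.
  by move=> i j; rewrite !mxE -dotC proj_adj.
pose c i := if insub i is Some i' then v 0 i' else 0.
pose e' := \sum_(i < size g) c i *: g`_i.
have cE (i : 'I_m.+1) : c i = v 0 i by rewrite /c valK.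
have e'g j : (j < size g)%N -> ip e' g`_j = c j by move=> jg; rewrite dot_span.
have e'0 : e' != 0.
  apply: contra v0 => /eqP e0; apply/eqP/rowP => j.
  by rewrite -cE -e'g ?sg // e0 linear0l mxE.
have [b b0 nb] := normalize ip e'0; set e0 := b *: e' in nb.
have Be0 y : y \in <<g>>%VS -> ip (proj ip f e0) y = a * ip e0 y.
  move=> yg; rewrite proj_adj // !linearZl_LR /= -proj_adj // mulrCA; congr (_ * _).
  apply/eqP; rewrite -subr_eq0 -linearZl_LR -linearBl; apply/eqP.
  apply: orthov_span yg => j; rewrite linearBl linearZl_LR /= => jg.
  rewrite e'g // proj_adj // linear_sumlz; rewrite sg in jg.
  have /rowP/(_ (Ordinal jg)) := vH; rewrite !mxE -cE /= => <-.
  apply/eqP; rewrite subr_eq0; apply/eqP; rewrite sg; apply: eq_bigr => i _.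
  by rewrite linearZl_LR /= !mxE cE.
have He0 : orthonormal ip [:: e0] by rewrite /orthonormal /= nb eqxx.
have e0g : e0 \in <<g>>%VS.
  by rewrite memvZ //; apply: memv_suml => i _; rewrite memvZ // memv_span // mem_nth.
have [|h [Hh hg]] := extend_orthonormal He0 (V := <<g>>%VS).
  by rewrite span_seq1 -memvE.
have sh : size h = m.
  apply: succn_inj; rewrite -sg -(eqP (orthonormal_free Hg)) -hg.
  by rewrite (eqP (orthonormal_free Hh)).
move: Hh; rewrite orthonormal_cons => /and3P[_ Hh /allP e0h].
have [|e [He eh Be]] := IH h _ Hh; first by rewrite sh.
have e0e u : u \in e -> ip e0 u = 0.
  move=> ue; apply: (@orthov_span _ _ _ _ h) => [i ih|]; last by rewrite -eh memv_span.
  by apply/eqP/e0h/mem_nth.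
have eg u : u \in e -> u \in <<g>>%VS.
  by move=> ue; rewrite -hg -cat1s span_cat (subvP (addvSr _ _)) // -eh memv_span.
exists (e0 :: e); split.
- by rewrite orthonormal_cons nb eqxx He; apply/allP => u /e0e ->.
- by rewrite -hg -[e0 :: e]cat1s -[_ ++ h]cat1s !span_cat eh.
move=> x y; rewrite !inE => /predU1P[->|xe] /predU1P[->|ye]; rewrite ?eqxx //.
- by move=> _; rewrite Be0 ?eg // e0e // mulr0.
- by move=> _; rewrite proj_adj // dotC Be0 ?eg // e0e // mulr0 rmorph0.
exact: Be.
Qed.

(** Take an orthonormal basis e of V diagonalizing <P x, y>, with P the
    projection onto W, ordered by decreasing norm c of P e_i.  The vectors
    P e_i are pairwise orthogonal; the normalized nonzero ones begin an
    orthonormal basis of W, and cos theta_i = c e_i. *)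
Lemma principal_angles_exist V W : (\dim V <= \dim W)%N ->
  exists theta, is_principal_angles ip V W theta.
Proof.
move=> pq.
have [f [/andP[/eqP fW _] Hf]] := orthonormal_basis_exists ip W.
have [g [/andP[/eqP gV _] Hg]] := orthonormal_basis_exists ip V.
have [e0 [He0 e0V Be0]] := codiagonal_basis Hg Hf.
have sqrtb u : exists t : R, 0 <= t /\ of_real t ^+ 2 = ip (proj ip f u) (proj ip f u).
  by have [t] := sqrt_ground (dot_ge0 ip (proj ip f u)); exists t.
have [c cP] := choice sqrtb.
have c_ge0 u : 0 <= c u by case: (cP u).
have cE u : ip (proj ip f u) u = of_real (c u) ^+ 2.
  by rewrite (proj2 (cP u)) dot_proj_proj // proj_adj.
have c_le1 u : ip u u = 1 -> c u <= 1.
  move=> u1; rewrite -(@expr_le1 _ 2) // -(@ler_of_real _ k) of_real1.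
  by rewrite expr2 of_realM -expr2 (proj2 (cP u)) -u1 proj_contract.
(* acos reverses the order, hence decreasing c. *)
pose leT u v := c v <= c u.
have leT_trans : transitive leT by move=> y x z xy yz; apply: le_trans yz xy.
pose es := sort leT e0.
(* In the sorted basis the vectors with P u = 0 come last anyway; splitting
   by filters makes the two blocks explicit. *)
pose e1 := [seq u <- es | c u != 0].
pose e2 := [seq u <- es | ~~ (c u != 0)].
have pe : perm_eq (e1 ++ e2) e0.
  by rewrite (permPl (permEl (perm_filterC _ _))) perm_sort.
pose e := e1 ++ e2.
have He : orthonormal ip e.
  have [ue oe] := orthonormal_memP _ _ He0.
  apply/orthonormal_memP; split; first by rewrite (perm_uniq pe).
  by move=> u v; rewrite !(perm_mem pe); exact: oe.
have Be : {in e &, forall u v, u != v -> ip (proj ip f u) v = 0}.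
  by move=> u v; rewrite !(perm_mem pe); exact: Be0.
have eV : <<e>>%VS = V by rewrite -gV -e0V; apply/eq_span/perm_mem.
have sze : size e = \dim V by rewrite -eV (eqP (orthonormal_free He)).
have ue := free_uniq (orthonormal_free He).
have e_sorted : sorted leT e.
  have es_sorted : sorted leT es.
    by apply: sort_sorted => u v; exact: le_total.
  rewrite sorted_pairwise // pairwise_cat -!sorted_pairwise //.
  rewrite !(sorted_filter leT_trans) // !andbT.
  apply/allrelP => u v _; rewrite mem_filter negbK => /andP[/eqP cv _].
  by rewrite /leT cv.
pose f1 := [seq (of_real (c u))^-1 *: proj ip f u | u <- e1].
have cn0 u : u \in e1 -> of_real (c u) != 0 :> F.
  rewrite mem_filter => /andP[cu _]; apply: contra cu => /eqP cu0.
  by rewrite -[c u](of_realK k) cu0 -(of_real0 R k) of_realK.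
have e1e u : u \in e1 -> u \in e by rewrite mem_cat => ->.
have szf1 : size f1 = size e1 by rewrite size_map.
have f1E i : (i < size e1)%N -> f1`_i = (of_real (c e1`_i))^-1 *: proj ip f e1`_i.
  by move=> ie; rewrite (nth_map 0).
have dot_f1 i v : (i < size e1)%N -> v \in e ->
    ip f1`_i v = if e1`_i == v then of_real (c v) else 0.
  move=> ie ve; rewrite f1E // linearZl_LR /=; case: eqVneq => [<-|ne].
    by rewrite cE expr2 mulrA mulVf ?mul1r // cn0 // mem_nth.
  by rewrite (Be _ _ (e1e _ (mem_nth 0 ie)) ve ne) mulr0.
have projr x y : x \in <<f>>%VS -> ip x (proj ip f y) = ip x y.
  by move=> xf; rewrite -proj_adj // proj_id.
have f1f u : u \in f1 -> u \in <<f>>%VS.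
  by move=> /mapP[w _ ->]; rewrite memvZ // proj_mem.
have Hf1 : orthonormal ip f1.
  apply/orthonormal_nthP => i j; rewrite szf1 => il jl.
  rewrite [f1`_j]f1E // linearZr_LR /= projr ?f1f ?mem_nth ?szf1 //.
  rewrite dot_f1 ?e1e ?mem_nth // nth_uniq //; last first.
    by move: ue; rewrite /e cat_uniq => /andP[].
  case: eqP => _; last by rewrite mulr0.
  rewrite fmorphV sconj_ge0 ?mulVf ?cn0 ?mem_nth //.
  by rewrite -(of_real0 R k) ler_of_real.
have [|f2 [Hff ffW]] := extend_orthonormal Hf1 (V := W).
  by apply/span_subvP => u /f1f; rewrite fW.
have szff : size (f1 ++ f2) = \dim W.
  by rewrite -ffW (eqP (orthonormal_free Hff)).
(* For j in the first block this is the orthogonality of the P e_j.  Otherwise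
   the left-hand side is <f_j, P e_i>, where P e_i is either a multiple of f_i
   with i != j, or 0. *)
have dot_ff i j : (i < \dim V)%N -> (j < \dim W)%N ->
    ip (f1 ++ f2)`_j e`_i = if i == j then of_real (c e`_i) else 0.
  move=> iV jW; have ie : e`_i \in e by rewrite mem_nth ?sze.
  have [jl|jl] := ltnP j (size e1).
    have ej : e1`_j = e`_j by rewrite /e nth_cat jl.
    rewrite nth_cat szf1 jl dot_f1 // ej nth_uniq ?sze 1?eq_sym //.
    by rewrite -sze (leq_trans jl) // size_cat leq_addr.
  have fjW : (f1 ++ f2)`_j \in <<f>>%VS.
    by rewrite fW -ffW memv_span // mem_nth // szff.
  rewrite -projr //; have [il|il] := ltnP i (size e1).
    have ei : e`_i = e1`_i by rewrite /e nth_cat il.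
    rewrite (ltn_eqF (leq_trans il jl)) ei.
    have -> : proj ip f e1`_i = of_real (c e1`_i) *: (f1 ++ f2)`_i.
      by rewrite nth_cat szf1 il f1E // scalerA mulfV ?scale1r // cn0 // mem_nth.
    rewrite linearZr_LR /= (orthonormal_nthP _ _ Hff) ?szff //.
      by rewrite (gtn_eqF (leq_trans il jl)) mulr0.
    exact: leq_trans il (leq_trans jl (ltnW jW)).
  have c0 : c e`_i = 0.
    have : e`_i \in e2.
      rewrite /e nth_cat ltnNge il /= mem_nth // -subSn // leq_subLR -size_cat.
      by rewrite -/e sze.
    by rewrite mem_filter negbK => /andP[/eqP].
  have /eqP : ip (proj ip f e`_i) (proj ip f e`_i) = 0.
    by rewrite -(proj2 (cP _)) c0 of_real0 expr0n.
  by rewrite dot_eq0 => /eqP ->; rewrite linear0r c0 of_real0 if_same.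
have c_le1e u : u \in e -> c u <= 1.
  by move=> ue'; apply: c_le1; rewrite (proj2 (orthonormal_memP _ _ He)) // eqxx.
exists [seq acos (c u) | u <- e]; split.
- by rewrite size_map sze; apply/esym/minn_idPl.
- apply: (@homo_sorted_in _ _ (mem e) (fun u => acos (c u)) leT) e_sorted; last exact/allP.
  by move=> u v ue' ve' uv; rewrite acos_anti // c_le1e.
- by move=> t /mapP[u ue' ->]; rewrite acos_pihalf // c_le1e.
exists e, (f1 ++ f2); rewrite !basisEdim He Hff eV ffW !subvv sze szff !leqnn.
split=> // i j iV jW; rewrite /inner dot_ff // (nth_map 0) ?sze // acosK //.
have ie : e`_i \in e by rewrite mem_nth ?sze.
by rewrite in_itv /= c_le1e // andbT (le_trans _ (c_ge0 _)) // lerN10.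
Qed.

End PrincipalAnglesExist.

(** * Alternating multilinear maps on lists of vectors *)

Section Alternating.
Variables (F : fieldType) (X : vectType F) (M : lmodType F).
Variables (theta : {rmorphism F -> F}) (D : seq X -> M).

(** The twist theta is the identity for linear maps, and the conjugation for
    conjugate-linear ones.  Working with lists of all lengths at once lets the
    same notions apply to exterior products and to Gram determinants. *)
Definition multilinear := forall s1 s2 a x y,
  D (s1 ++ (a *: x + y) :: s2) =
  theta a *: D (s1 ++ x :: s2) + D (s1 ++ y :: s2).

Definition alternating := forall s1 s2 x, D (s1 ++ x :: x :: s2) = 0.

Hypothesis Dlin : multilinear.
Hypothesis Dalt : alternating.

Lemma multilinearD s1 s2 x y :
  D (s1 ++ (x + y) :: s2) = D (s1 ++ x :: s2) + D (s1 ++ y :: s2).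
Proof. by rewrite -{1}[x]scale1r Dlin rmorph1 scale1r. Qed.

Lemma multilinear0 s1 s2 : D (s1 ++ 0 :: s2) = 0.
Proof. by apply: (addrI (D (s1 ++ 0 :: s2))); rewrite -multilinearD !addr0. Qed.

Lemma multilinear_sum I (r : seq I) (c : I -> F) (x : I -> X) s1 s2 :
  D (s1 ++ (\sum_(i <- r) c i *: x i) :: s2) =
  \sum_(i <- r) theta (c i) *: D (s1 ++ x i :: s2).
Proof.
elim: r => [|i r IH]; first by rewrite !big_nil multilinear0.
by rewrite !big_cons Dlin IH.
Qed.

Lemma alternating_swap s1 s2 x y : D (s1 ++ x :: y :: s2) = - D (s1 ++ y :: x :: s2).
Proof.
apply/eqP; rewrite -addr_eq0; apply/eqP; rewrite -(Dalt s1 s2 (x + y)).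
rewrite multilinearD -!(cat_rcons _ _ ((x + y) :: s2)) !multilinearD !cat_rcons.
by rewrite !Dalt add0r addr0.
Qed.

(** Sorting one vector at a time: moving x to the front past t1 is a sequence of
    adjacent transpositions.  The prefix s1 makes the induction go through. *)
Lemma alternating_perm s t : perm_eq s t -> exists b : bool, D s = (-1) ^+ b *: D t.
Proof.
have bring x t1 t2 s1 : exists b : bool,
    D (s1 ++ x :: t1 ++ t2) = (-1) ^+ b *: D (s1 ++ t1 ++ x :: t2).
  elim: t1 s1 => [|y t1 IH] s1; first by exists false; rewrite scale1r.
  have [b Db] := IH (rcons s1 y); exists (~~ b).
  by rewrite alternating_swap -cat_rcons Db cat_rcons signrN scaleNr.
suff main s1 : perm_eq s t -> exists b : bool, D (s1 ++ s) = (-1) ^+ b *: D (s1 ++ t).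
  exact: (main [::]).
elim: s t s1 => [|x s IH] t s1 st.
  have -> : t = [::] by apply/perm_nilP; rewrite perm_sym.
  by exists false; rewrite scale1r.
have xt : x \in t by rewrite -(perm_mem st) mem_head.
case/splitPr: t / xt st => t1 t2 st.
have [|b Db] := IH (t1 ++ t2) (rcons s1 x).
  by rewrite -(perm_cons x) (permPl st) -cat_rcons -cats1 perm_catAC perm_catC.
have [b' Db'] := bring x t1 t2 s1; exists (b (+) b').
by rewrite -cat_rcons Db cat_rcons Db' scalerA -signr_addb.
Qed.

Lemma alternating_not_uniq s : ~~ uniq s -> D s = 0.
Proof.
move=> us; suff [x [t /alternating_perm[b ->]]] : exists x t, perm_eq s (x :: x :: t).
  by rewrite (Dalt [::]) scaler0.
elim: s us => //= x s IH; rewrite negb_and negbK => /orP[xs|/IH[y [t st]]].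
  by exists x, (rem x s); rewrite perm_cons perm_to_rem.
exists y, (x :: t); rewrite perm_sym (perm_catCA [:: y; y] [:: x] t).
by rewrite perm_cons perm_sym.
Qed.

(** By multilinearity it is enough to consider lists of basis vectors.  Such a
    list either has a repetition, or is a permutation of the increasing
    enumeration of the set of its indices. *)
Lemma alternating_eq0 :
  (forall S : {set 'I_(\dim {:X})}, D [seq (vbasis {:X})`_i | i : 'I__ <- enum S] = 0) ->
  forall s, D s = 0.
Proof.
move=> D0.
have Db (t : seq 'I_(\dim {:X})) : D [seq (vbasis {:X})`_i | i : 'I__ <- t] = 0.
  have [ut|ut] := boolP (uniq t); last first.
    by apply: alternating_not_uniq; apply: contra ut; exact: map_uniq.
  have pt : perm_eq t (enum [set x in t]).
    by apply: uniq_perm; rewrite ?enum_uniq // => x; rewrite mem_enum inE.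
  have [b ->] := alternating_perm (perm_map (fun i : 'I__ => (vbasis {:X})`_i) pt).
  by rewrite D0 scaler0.
(* The vectors already expanded in the basis are accumulated in t. *)
suff main s (t : seq 'I_(\dim {:X})) : D ([seq (vbasis {:X})`_i | i : 'I__ <- t] ++ s) = 0.
  by move=> s; exact: (main s [::]).
elim: s t => [|x s IH] t; first by rewrite cats0.
rewrite (coord_vbasis (memvf x)) multilinear_sum big1 // => i _.
by rewrite -cat_rcons -map_rcons IH scaler0.
Qed.

End Alternating.

(** * The inner product of exterior products *)

(** The exchange of two factors in [extvec_sq], with s the sign that the
    transposition of i and j contributes. *)
Lemma signed_swap (A : comPzRingType) (x y s p q z : A) :
  x * (- s * q * (y * (p * z))) = - (y * (s * p * (x * (q * z)))).
Proof.
rewrite !mulNr mulrN; congr (- _); rewrite !mulrA.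
rewrite [x * s]mulrC [y * s]mulrC -!mulrA; congr (_ * _).
by rewrite [p * (x * _)]mulrCA [q * (y * _)]mulrCA [LHS]mulrCA [q * (p * _)]mulrCA.
Qed.

Section Exterior.
Variables (R : realType) (k : ground) (X : vectType (ground_field R k)).
Variable ip : {dot X for sconj}.
Local Notation F := (ground_field R k).
Local Notation I := 'I_(\dim {:X}).
Local Notation b := (vbasis {:X}).
Implicit Types (u v w x y : X) (s t : seq X) (S T U : {set I}) (i j : I).
Implicit Types (a c : extalg X).

Definition below (i : I) (T : {set I}) : nat := #|[set j in T | (j < i)%N]|.

Lemma belowD1 i j T : j \in T -> below i T = ((j < i) + below i (T :\ j))%N.
Proof.
move=> jT; rewrite /below (cardsD1 j) !inE jT /=; congr (_ + #|pred_of_set _|)%N.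
by apply/setP => l; rewrite !inE andbA.
Qed.

Lemma inversions1 i T : inversions [set i] T = below i T.
Proof.
have inj : injective (fun j => (i, j)) by move=> j l [].
rewrite /inversions /below -(card_imset _ inj); apply: eq_card => -[l j].
rewrite !inE /=; apply/and3P/imsetP => [[/eqP -> jT ji]|[m]].
  by exists j; rewrite ?inE ?jT.
by rewrite inE => /andP[mT mi] [-> ->].
Qed.

(** Left multiplication by a vector removes one index i from U at a time, with
    the sign of moving e_i to its place in e_U. *)
Lemma extmul_extvecE v a U : extmul (extvec v) a U =
  \sum_(i in U) coord b i v * ((-1) ^+ below i (U :\ i) * a (U :\ i)).
Proof.
rewrite ffunE; under eq_bigr => S _.
  rewrite ffunE mulr_suml mulr_sumr; over.
rewrite /= exchange_big /= [RHS]big_mkcond; apply: eq_bigr => i _.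
rewrite big_mkcond (bigD1 [set i]) //= big1 ?addr0 => [|S /negPf Si]; last first.
  by rewrite Si mulr0 mul0r mulr0 if_same.
by rewrite finset.sub1set eqxx mulr1 inversions1 mulrCA.
Qed.

Lemma extmulDl a c d : extmul (a + c) d = extmul a d + extmul c d.
Proof.
apply/ffunP => U; rewrite !ffunE -big_split; apply: eq_bigr => S _ /=.
by rewrite ffunE mulrDl mulrDr.
Qed.

Lemma extmulDr a c d : extmul d (a + c) = extmul d a + extmul d c.
Proof.
apply/ffunP => U; rewrite !ffunE -big_split; apply: eq_bigr => S _ /=.
by rewrite ffunE !mulrDr.
Qed.

Lemma extmulZr (l : F) a c : extmul c (l *: a) = l *: extmul c a.
Proof.
apply/ffunP => U; rewrite !ffunE scaler_sumr; apply: eq_bigr => S _ /=.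
by rewrite ffunE /GRing.scale /=; rewrite (mulrCA _ l) (mulrCA _ l).
Qed.

Lemma extmulZl (l : F) a c : extmul (l *: a) c = l *: extmul a c.
Proof.
apply/ffunP => U; rewrite !ffunE scaler_sumr; apply: eq_bigr => S _ /=.
by rewrite ffunE /GRing.scale /= -mulrA (mulrCA _ l).
Qed.

Lemma extvecD x y : extvec (x + y) = extvec x + extvec y.
Proof.
apply/ffunP => S; rewrite !ffunE -big_split; apply: eq_bigr => i _ /=.
by rewrite linearD mulrDl.
Qed.

Lemma extvecZ (l : F) x : extvec (l *: x) = l *: extvec x.
Proof.
apply/ffunP => S; rewrite !ffunE scaler_sumr; apply: eq_bigr => i _ /=.
by rewrite linearZ /= -mulrA.
Qed.

(** In the double sum over ordered pairs of distinct i, j in U, exchanging i and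
    j changes the sign of each term: removing i first alters by one the number
    of indices below j exactly when i < j.  So the sum is its own opposite. *)
Lemma extvec_sq v a : extmul (extvec v) (extmul (extvec v) a) = 0.
Proof.
apply/ffunP => U; rewrite extmul_extvecE ffunE.
pose G i j := coord b i v * ((-1) ^+ below i (U :\ i) *
  (coord b j v * ((-1) ^+ below j (U :\ i :\ j) * a (U :\ i :\ j)))).
under eq_bigr => i _ do rewrite extmul_extvecE !mulr_sumr.
pose P i j := [&& i \in U, j \in U & i != j].
have -> : \sum_(i in U) \sum_(j in U :\ i) G i j = \sum_i \sum_(j | P i j) G i j.
  rewrite big_mkcond; apply: eq_bigr => i _; case: ifP => iU.
    by apply: eq_bigl => j; rewrite !inE /P iU andbC eq_sym.
  by rewrite big_pred0 // => j; rewrite /P iU.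
have GC i j : P i j -> G j i = - G i j.
  move=> /and3P[iU jU ij]; rewrite /G.
  have -> : U :\ j :\ i = U :\ i :\ j by rewrite finset.setDDl finset.setUC -finset.setDDl.
  rewrite (@belowD1 i j (U :\ i)) ?inE ?jU ?andbT 1?eq_sym //.
  rewrite (@belowD1 j i (U :\ j)) ?inE ?iU ?andbT //.
  have -> : U :\ j :\ i = U :\ i :\ j by rewrite finset.setDDl finset.setUC -finset.setDDl.
  rewrite !exprD.
  set p := (-1) ^+ below i _; set q := (-1) ^+ below j _.
  have -> : (-1) ^+ (i < j)%N = - (-1) ^+ (j < i)%N :> F.
    case: (ltngtP i j) => [_|_|/val_inj ij']; rewrite ?expr0 ?expr1 ?opprK //.
    by rewrite ij' eqxx in ij.
  exact: signed_swap.
(* x = 0 as soon as x + x = 0. *)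
apply/eqP; rewrite -[_ == _](mulrn_eq0 _ 2); apply/eqP; rewrite mulr2n.
rewrite {2}(exchange_big_dep xpredT) //= -big_split big1 // => i _ /=.
rewrite [X in _ + X](eq_big (P i) (fun j => - G i j)) ?sumrN ?subrr //.
  by move=> j; rewrite /P eq_sym andbCA.
by move=> j Pji; rewrite GC //; move: Pji; rewrite /P eq_sym andbCA.
Qed.

Lemma wedge_multilinear : multilinear idfun (@wedge R k X).
Proof.
move=> s1 s2 l x y; elim: s1 => [|z s1 IH] /=.
  by rewrite extvecD extvecZ extmulDl extmulZl.
by rewrite -/(wedge _) IH extmulDr extmulZr.
Qed.

Lemma wedge_alternating : alternating (@wedge R k X).
Proof.
move=> s1 s2 x; elim: s1 => [|z s1 IH] /=; first exact: extvec_sq.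
by rewrite -/(wedge _) IH -[X in extmul _ X](scale0r (0 : extalg X)) extmulZr scale0r.
Qed.

Definition basis_blade S : extalg X := [ffun T => (T == S)%:R].

(** Multiplying by e_i on the left, with i below all the indices of t, creates
    no inversion and hence no sign. *)
Lemma wedge_sorted (t : seq I) : sorted ltn (map val t) ->
  wedge [seq b`_i | i : I <- t] = basis_blade [set i in t].
Proof.
elim: t => [|i t IH] /= it.
  by apply/ffunP => S; rewrite !ffunE; congr (_ == _)%:R; apply/setP => i; rewrite !inE.
rewrite -/(wedge _) IH ?(path_sorted it) //; apply/ffunP => U.
have lt_i j : j \in t -> (i < j)%N.
  by move=> jt; apply: (allP (order_path_min ltn_trans it)); apply: map_f.
have it' : i \notin t by apply/negP => /lt_i; rewrite ltnn.
rewrite extmul_extvecE !ffunE.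
have coordb j : coord b j b`_i = (j == i)%:R.
  by rewrite coord_free ?(basis_free (vbasisP _)) // eq_sym.
under eq_bigr => j _ do rewrite coordb.
have [iU|iU] := boolP (i \in U); last first.
  rewrite big1 => [|j jU].
    case: eqP => // UE; case/negP: iU; by rewrite UE !inE eqxx.
  by case: eqP => [ji|]; rewrite ?mul0r //; rewrite -ji jU in iU.
rewrite (bigD1 i) //= big1 ?addr0 => [|j /andP[_ /negPf ->]]; last by rewrite mul0r.
rewrite eqxx mul1r ffunE.
have -> : (U == [set j in i :: t]) = (U :\ i == [set j in t]).
  apply/eqP/eqP => [->|Ut]; apply/setP => j.
    by rewrite !inE; case: eqP => [->|]; rewrite ?(negPf it').
  by move/setP/(_ j): Ut; rewrite !inE; case: eqP => [->|] //=; rewrite iU.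
case: eqP => [->|]; last by rewrite mulr0.
rewrite (_ : below _ _ = 0%N) ?expr0 ?mulr1 //; apply/eqP; rewrite cards_eq0.
apply/eqP/setP => j; rewrite !inE; apply/negP => /andP[/lt_i ij ji].
by move: (ltn_trans ij ji); rewrite ltnn.
Qed.

Lemma wedge_blade S : wedge (blade S) = basis_blade S.
Proof.
rewrite /blade wedge_sorted.
  by congr basis_blade; apply/setP => i; rewrite inE mem_enum.
rewrite sorted_map /enum_mem; apply: sorted_filter.
  by move=> j i l; exact: ltn_trans.
by rewrite -enumT -sorted_map val_enum_ord iota_ltn_sorted.
Qed.

Lemma ext_innerDl a c d (l : F) :
  ext_inner ip (l *: a + c) d = sconj l * ext_inner ip a d + ext_inner ip c d.
Proof.
rewrite /ext_inner mulr_sumr -big_split; apply: eq_bigr => S _ /=.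
rewrite mulr_sumr -big_split; apply: eq_bigr => T _ /=.
by rewrite !ffunE rmorphD rmorphM /= !mulrDl !mulrA.
Qed.

Lemma ext_innerDr a c d (l : F) :
  ext_inner ip d (l *: a + c) = l * ext_inner ip d a + ext_inner ip d c.
Proof.
rewrite /ext_inner mulr_sumr -big_split; apply: eq_bigr => S _ /=.
rewrite mulr_sumr -big_split; apply: eq_bigr => T _ /=.
by rewrite !ffunE mulrDr mulrDl !mulrA [_ * l]mulrC.
Qed.

Lemma ext_inner0l a : ext_inner ip 0 a = 0.
Proof.
have := ext_innerDl 0 0 a 1; rewrite scaler0 addr0 rmorph1 mul1r -[LHS]addr0.
by move=> /addrI/esym.
Qed.

Lemma ext_inner0r a : ext_inner ip a 0 = 0.
Proof.
have := ext_innerDr 0 0 a 1; rewrite scaler0 addr0 mul1r -[LHS]addr0.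
by move=> /addrI/esym.
Qed.

Lemma ext_innerZ (l m : F) a c :
  ext_inner ip (l *: a) (m *: c) = sconj l * m * ext_inner ip a c.
Proof.
have := ext_innerDl a 0 (m *: c) l; rewrite addr0 ext_inner0l addr0 => ->.
have := ext_innerDr c 0 a m; rewrite addr0 ext_inner0r addr0 => ->.
by rewrite mulrA.
Qed.

Lemma ext_inner_basis_blade S T :
  ext_inner ip (basis_blade S) (basis_blade T) = gram ip (blade S) (blade T).
Proof.
rewrite /ext_inner (bigD1 S) //= [X in _ + X]big1 => [|S' /negPf SS]; last first.
  by rewrite big1 // => T' _; rewrite !ffunE SS rmorph0 !mul0r.
rewrite (bigD1 T) //= [X in _ + X + _]big1 => [|T' /negPf TT]; last first.
  by rewrite !ffunE TT mulr0 mul0r.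
by rewrite !ffunE !eqxx rmorph1 !mul1r !addr0.
Qed.

(** The lists of a length other than that of t satisfy this trivially, since
    [gram] vanishes on them. *)
Lemma gram_multilinearl t :
  multilinear sconj (fun s => gram ip s t : F^o).
Proof.
move=> s1 s2 l x y /=.
have sz z : size (s1 ++ z :: s2) = (size s1 + size s2).+1.
  by rewrite size_cat /= addnS.
have [st|st] := eqVneq (size t) (size s1 + size s2).+1; last first.
  by rewrite !gram_size ?scaler0 ?addr0 // sz eq_sym.
rewrite !(gramE _ (sz _) st).
have i0P : (size s1 < (size s1 + size s2).+1)%N by rewrite ltnS leq_addr.
have nth_off z z' (i : 'I_(size s1 + size s2)) :
    (s1 ++ z :: s2)`_(lift (Ordinal i0P) i) = (s1 ++ z' :: s2)`_(lift (Ordinal i0P) i).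
  rewrite !nth_cat /=; case: ltnP => // ni; case nE: (_ - _)%N => //=.
  move/eqP: nE; rewrite subn_eq0 => in'.
  by have := neq_bump (size s1) i; rewrite eqn_leq ni in'.
rewrite -[X in _ = _ + X]mul1r; apply: (determinant_multilinear (i0 := Ordinal i0P)).
- apply/rowP => j; rewrite !mxE !nth_cat /= ltnn subnn /= linearDr linearZr_LR /=.
  by rewrite mul1r.
- by apply/matrixP => i j; rewrite !mxE; congr (ip _ _); exact: nth_off.
- by apply/matrixP => i j; rewrite !mxE; congr (ip _ _); exact: nth_off.
Qed.

Lemma gram_alternatingl t : alternating (fun s => gram ip s t : F^o).
Proof.
move=> s1 s2 x /=.
have sz : size (s1 ++ x :: x :: s2) = (size s1 + size s2).+2.
  by rewrite size_cat /= !addnS.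
have [st|st] := eqVneq (size t) (size s1 + size s2).+2; last first.
  by rewrite gram_size // sz eq_sym.
rewrite (gramE _ sz st).
have i0P : (size s1 < (size s1 + size s2).+2)%N by rewrite ltnS -addnS leq_addr.
have i1P : ((size s1).+1 < (size s1 + size s2).+2)%N by rewrite !ltnS leq_addr.
apply: (determinant_alternate (i1 := Ordinal i0P) (i2 := Ordinal i1P)).
  by rewrite -val_eqE /= neq_ltn ltnSn.
by move=> j; rewrite !mxE !nth_cat /= ltnn subnn ltnNge leqnSn /= subSnn.
Qed.

Lemma gram_multilinearr s : multilinear idfun (fun t => gram ip s t : F^o).
Proof.
move=> s1 s2 l x y /=; rewrite !(gramC _ s).
have /= -> := gram_multilinearl s s1 s2 l x y.
by rewrite rmorphD rmorphM /= sconjK.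
Qed.

Lemma gram_alternatingr s : alternating (fun t => gram ip s t : F^o).
Proof.
move=> s1 s2 x /=; rewrite gramC.
by have /= -> := gram_alternatingl s s1 s2 x; rewrite rmorph0.
Qed.

(** The difference of the two sides is alternating and multilinear in s (with
    the conjugation), so it suffices to take for s a blade; for such s it is
    alternating and linear in t, so t can be taken to be a blade as well. *)
Lemma ext_inner_wedge s t : ext_inner ip (wedge s) (wedge t) = gram ip s t.
Proof.
apply/eqP; rewrite -subr_eq0; apply/eqP.
apply: (@alternating_eq0 _ _ F^o sconj
  (fun s => ext_inner ip (wedge s) (wedge t) - gram ip s t)).
- move=> s1 s2 l x y /=; rewrite wedge_multilinear ext_innerDl.
  have /= -> := gram_multilinearl t s1 s2 l x y.
  by rewrite /GRing.scale /= mulrBr opprD addrACA.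
- move=> s1 s2 x /=; rewrite wedge_alternating ext_inner0l.
  by have /= -> := gram_alternatingl t s1 s2 x; rewrite subr0.
move=> S; apply: (@alternating_eq0 _ _ F^o idfun
  (fun t => ext_inner ip (wedge (blade S)) (wedge t) - gram ip (blade S) t)).
- move=> s1 s2 l x y /=; rewrite wedge_multilinear ext_innerDr.
  have /= -> := gram_multilinearr (blade S) s1 s2 l x y.
  by rewrite /GRing.scale /= mulrBr opprD addrACA.
- move=> s1 s2 x /=; rewrite wedge_alternating ext_inner0r.
  by have /= -> := gram_alternatingr (blade S) s1 s2 x; rewrite subr0.
by move=> T; rewrite !wedge_blade ext_inner_basis_blade subrr.
Qed.

End Exterior.

(** * Lines of the Grassmann algebra and their distance *)

Section Lines.
Variables (R : realType) (k : ground) (X : vectType (ground_field R k)).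
Variable ip : {dot X for sconj}.
Local Notation F := (ground_field R k).
Implicit Types (u v w x y : X) (e f g s t : seq X) (U V W : {vspace X}).

(** A list of dim U vectors of the basis of U either has a repetition, and its
    product is 0, or is a permutation of the basis, and its product is that of
    the basis up to sign. *)
Lemma extpow_dim_line U : extpow (\dim U) U = <[wedge (vbasis U)]>%VS.
Proof.
have subsetU (t : seq 'I_(\dim U)) : [seq (vbasis U)`_i | i : 'I__ <- t] =
    map (nth 0 (vbasis U)) (map val t) by rewrite -map_comp.
have all_basis : [seq (vbasis U)`_i | i : 'I__ <- enum 'I_(\dim U)] = vbasis U.
  by rewrite subsetU val_enum_ord -{2}(mkseq_nth 0 (vbasis U)) size_tuple.
apply/eqP; rewrite eqEsubv; apply/andP; split; last first.
  rewrite -memvE memv_span //; apply/mapP; exists (ord_tuple (\dim U)).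
    by rewrite mem_enum.
  by rewrite val_ord_tuple all_basis.
apply/span_subvP => _ /mapP[t _ ->].
have wl := @wedge_multilinear R k X; have wa := @wedge_alternating R k X.
have [ut|ut] := boolP (uniq t); last first.
  rewrite (alternating_not_uniq wl wa) ?mem0v //.
  by apply: contra ut; exact: map_uniq.
have pt : perm_eq t (enum 'I_(\dim U)).
  apply: uniq_perm; rewrite ?enum_uniq // => i; rewrite mem_enum inE.
  have [||_ ->] := uniq_min_size ut (s2 := enum 'I_(\dim U)).
  - by move=> j _; rewrite mem_enum.
  - by rewrite -cardE card_ord size_tuple.
  by rewrite mem_enum.
have [b ->] := alternating_perm wl wa (perm_map (fun i : 'I__ => (vbasis U)`_i) pt).
by rewrite all_basis memvZ // memv_line.
Qed.

Lemma vpick_extpow U (l : projective (extalg X)) : val l = extpow (\dim U) U ->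
  exists (c : F) (u : seq X),
    [/\ c != 0, free u, << u >>%VS = U & vpick (val l) = c *: wedge u].
Proof.
move=> lU; have : vpick (val l) \in val l by exact: memv_pick.
rewrite {2}lU extpow_dim_line => /vlineP[c pE]; exists c, (vbasis U); split=> //.
- apply: contraTneq (valP l) => c0; rewrite c0 scale0r in pE.
  by move/eqP: pE; rewrite vpick0 => /eqP ->; rewrite dimv0.
- exact: basis_free (vbasisP U).
- exact: span_basis (vbasisP U).
Qed.

(** A nonzero vector of the line of U is c u_1 ^ ... ^ u_p with u a basis of U.
    Replacing it by e_1 ^ ... ^ e_p divides its norm and the moduli of its scalar
    products with other products of vectors by the same number, which cancels in
    the quotient. *)
Lemma fubini_studyE U U' e e' (l m : projective (extalg X)) :
    val l = extpow (\dim U) U -> val m = extpow (\dim U') U' ->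
    orthonormal ip e -> <<e>>%VS = U -> orthonormal ip e' -> <<e'>>%VS = U' ->
  fubini_study ip l m = acos (to_real `|gram ip e e'|).
Proof.
move=> lU mU He eU He' eU'; rewrite /fubini_study.
have [c [u [c0 fu spu ->]]] := vpick_extpow lU.
have [d [u' [d0 fu' spu' ->]]] := vpick_extpow mU.
have su : size u = size e by rewrite -(eqP fu) spu -eU (eqP (orthonormal_free He)).
have su' : size u' = size e' by rewrite -(eqP fu') spu' -eU' (eqP (orthonormal_free He')).
have gu : gram ip e u != 0 by apply: gram_basis_neq0; rewrite // eU spu.
have gu' : gram ip e' u' != 0 by apply: gram_basis_neq0; rewrite // eU' spu'.
have ue : {subset u <= <<e>>%VS} by move=> x; rewrite eU -spu; exact: memv_span.
have ue' : {subset u' <= <<e'>>%VS} by move=> x; rewrite eU' -spu'; exact: memv_span.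
have guu : gram ip u u = `|gram ip e u| ^+ 2.
  by rewrite (gram_mulr He) // [gram ip u e]gramC mulrC -sqr_norm_sconj.
have guu' : gram ip u' u' = `|gram ip e' u'| ^+ 2.
  by rewrite (gram_mulr He') // [gram ip u' e']gramC mulrC -sqr_norm_sconj.
have guv : gram ip u u' = sconj (gram ip e u) * gram ip e e' * gram ip e' u'.
  have [ee|ee] := eqVneq (size e) (size e'); last first.
    by rewrite [gram ip u u']gram_size ?su ?su' // [gram ip e e']gram_size // mulr0 mul0r.
  rewrite (gram_mulr He') ?su //; congr (_ * _).
  by rewrite [LHS]gramC (gram_mulr He) // rmorphM /= -(gramC ip e e') mulrC.
have normE (x y : F) : y = `|x| ^+ 2 -> Num.sqrt (to_real y) = to_real `|x|.
  move=> ->; rewrite -normrX expr2 to_real_normM -expr2 sqrtr_sqr ger0_norm //.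
  exact: to_real_norm_ge0.
rewrite /ext_norm !ext_innerZ !ext_inner_wedge.
rewrite (normE (c * gram ip e u)) ?(normE (d * gram ip e' u')).
- congr acos; rewrite guv !to_real_normM !norm_sconj.
  have nz (x : F) : x != 0 -> to_real `|x| != 0.
    move=> x0; apply: contra x0 => /eqP n0.
    by rewrite -normr_eq0 -(@to_realK _ _ `|x|) // n0 of_real0 eqxx.
  have reorder (a b x y g : R) : a * b * (x * g * y) = g * (a * x * (b * y)).
    by ring.
  by rewrite reorder mulfK // !mulf_neq0 // nz.
- by rewrite guu' normrM exprMn [`|d| ^+ 2]sqr_norm_sconj [sconj d * d]mulrC.
- by rewrite guu normrM exprMn [`|c| ^+ 2]sqr_norm_sconj [sconj c * c]mulrC.
Qed.

End Lines.

(** * The directed distance between full Grassmannians *)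

Section Final.
Variables (R : realType) (k : ground) (X : vectType (ground_field R k)).
Variable ip : {dot X for sconj}.
Local Notation F := (ground_field R k).
Implicit Types (u v w x y : X) (e f g s t : seq X) (U V W : {vspace X}).

(** The projection of e_i on W is cos theta_i f_i, so the row of e_i in a matrix
    of scalar products with vectors of W is cos theta_i times the row of f_i.
    Here f is the part of the principal basis of W that is paired with e.  The
    further rows r let [prod_cos_mono] complete e to a basis of a larger
    space. *)
Lemma principal_gram V W theta : (\dim V <= \dim W)%N ->
  is_principal_angles ip V W theta ->
  exists e f, [/\ orthonormal ip e /\ <<e>>%VS = V,
    orthonormal ip f /\ size f = \dim V, (<<f>> <= W)%VS &
    forall r g, {subset g <= W} ->
      gram ip (e ++ r) g = of_real (\prod_(t <- theta) cos t) * gram ip (f ++ r) g].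
Proof.
move=> VW [szt _ _ [e [f [/andP[be He] /andP[bf Hf] ef]]]].
rewrite (minn_idPl VW) in szt.
have sze : size e = \dim V by rewrite -(span_basis be) (eqP (basis_free be)).
have szf : size f = \dim W by rewrite -(span_basis bf) (eqP (basis_free bf)).
have szF : size (take (\dim V) f) = \dim V by rewrite size_takel // szf.
have fW : <<f>>%VS = W := span_basis bf.
have HF : orthonormal ip (take (\dim V) f).
  apply/orthonormal_nthP => i j; rewrite szF => iV jV; rewrite !nth_take //.
  by rewrite (orthonormal_nthP _ _ Hf) // szf (leq_trans _ VW).
exists e, (take (\dim V) f); split=> //; first by split=> //; exact: span_basis be.
  by rewrite -fW; apply/span_subvP => x /mem_take; exact: memv_span.
move=> r g gW.
have efE i j : (i < \dim V)%N -> (j < \dim W)%N ->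
    ip f`_j e`_i = if i == j then of_real (cos theta`_i) else 0 by exact: ef.
pose c i : F := if (i < \dim V)%N then of_real (cos theta`_i) else 1.
rewrite (@gram_scale _ _ _ ip (e ++ r) (take (\dim V) f ++ r) g c).
- congr (_ * _); rewrite of_real_prod (big_nth 0) szt size_cat sze.
  rewrite -(big_mkord xpredT c) (@big_cat_nat _ _ _ (\dim V)) ?leq_addr //=.
  rewrite [X in _ * X]big_nat_cond [X in _ * X]big1 ?mulr1 => [|i /andP[/andP[Vi _] _]].
    by rewrite big_nat [RHS]big_nat; apply: eq_bigr => i /= iV; rewrite /c iV.
  by rewrite /c ltnNge Vi.
- by rewrite !size_cat szF sze.
move=> i j il jl; rewrite !nth_cat szF sze /c; case: ltnP => [iV|_]; last by rewrite mul1r.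
have gf : g`_j \in <<f>>%VS by rewrite fW gW // mem_nth.
rewrite nth_take // -(proj_id Hf gf) (dot_span (fun l => ip g`_j f`_l)) //; last first.
  by rewrite szf (leq_trans iV).
rewrite linear_sumlz; have il' : (i < size f)%N by rewrite szf (leq_trans iV).
rewrite (bigD1 (Ordinal il')) //= big1 ?addr0 => [|l li].
  by rewrite linearZl_LR /= efE ?eqxx ?(leq_trans iV) // mulrC.
rewrite linearZl_LR /= efE -?szf //.
rewrite (_ : _ == _ = false) ?mulr0 //; apply/negbTE.
by rewrite eq_sym.
Qed.

Lemma prod_cos_bound V W theta : is_principal_angles ip V W theta ->
  0 <= \prod_(t <- theta) cos t <= 1.
Proof.
move=> [_ _ tb _]; rewrite big_seq; apply: (big_ind (fun p : R => 0 <= p <= 1)).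
- by rewrite ler01 lexx.
- by move=> p q /andP[p0 p1] /andP[q0 q1]; rewrite mulr_ge0 ?mulr_ile1.
move=> t /tb /andP[t0 t1]; rewrite cos_le1 andbT cos_ge0_pihalf // t1 andbT.
by rewrite (le_trans _ t0) // oppr_le0 divr_ge0 // pi_ge0.
Qed.

Lemma grassmann_angle_gt V W : (\dim W < \dim V)%N -> grassmann_angle ip V W = pi / 2.
Proof.
by rewrite /grassmann_angle => WV; rewrite gtn_eqF ?(leq_trans _ WV) // leqNgt WV /= if_same.
Qed.

(** For V = 0 the list of angles is empty and the empty product gives
    acos 1 = 0, in agreement with the convention for the zero subspace. *)
Lemma grassmann_angle_le V W : (\dim V <= \dim W)%N ->
  exists theta, is_principal_angles ip V W theta /\
    grassmann_angle ip V W = acos (\prod_(t <- theta) cos t).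
Proof.
move=> VW; have [theta thetaP] := principal_angles_exist ip VW.
rewrite /grassmann_angle VW; have [V0|V0] := eqVneq (\dim V) 0%N.
  exists theta; split=> //; case: thetaP; rewrite V0 min0n => /size0nil -> _ _ _.
  by rewrite big_nil acos1.
rewrite gtn_eqF ?(leq_trans _ VW) ?lt0n //.
exists (principal_angles ip V W); split=> //.
by apply: (@xgetPex _ [::] [set theta | is_principal_angles ip V W theta]%classic); exists theta.
Qed.

(** The left-hand side is |gram (eU, r) fV| for any completion r of eU to an
    orthonormal basis of V.  Pulling out the cosines of (U, W) leaves a
    determinant whose rows come from unit vectors. *)
Lemma prod_cos_mono U V W tU tV : (U <= V)%VS -> (\dim V <= \dim W)%N ->
  is_principal_angles ip U W tU -> is_principal_angles ip V W tV ->
  \prod_(t <- tV) cos t <= \prod_(t <- tU) cos t.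
Proof.
move=> UV VW aU aV.
have UW : (\dim U <= \dim W)%N := leq_trans (dimvS UV) VW.
have [eU [fU [[HeU eUU] [HfU sfU] fUW eqU]]] := principal_gram UW aU.
have [eV [fV [[HeV eVV] [HfV sfV] fVW eqV]]] := principal_gram VW aV.
have fVg : {subset fV <= W} by apply/span_subvP.
have /andP[PU0 _] := prod_cos_bound aU; have /andP[PV0 _] := prod_cos_bound aV.
have [|r [Hr rV]] := extend_orthonormal HeU (V := V); first by rewrite eUU.
have := eqV [::] fV fVg; rewrite !cats0 gram_orthonormal // mulr1 => gV.
have gU := eqU r fV fVg.
have normr_of_real (a : R) : 0 <= a -> `|of_real a : F| = of_real a.
  by move=> a0; rewrite ger0_norm // -(of_real0 R k) ler_of_real.
rewrite -(@ler_of_real R k) -(normr_of_real _ PV0) -gV.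
rewrite (gram_norm_span HeV Hr) ?rV ?sfV //; last first.
  by rewrite -(eqP (orthonormal_free HeV)) eVV.
rewrite gU normrM normr_of_real //; rewrite ler_piMr -?(of_real0 R k) ?ler_of_real //.
apply: gram_Hadamard => // x; rewrite mem_cat => /orP[xf|xr].
  by have [_ ->] := orthonormal_memP _ _ HfU; rewrite // eqxx.
have [_ ->] := orthonormal_memP _ _ Hr; rewrite ?mem_cat ?xr ?orbT // eqxx //.
Qed.

Lemma dim_extpow_dim U : \dim (extpow (\dim U) U) == 1%N.
Proof.
rewrite extpow_dim_line dim_vline eqb1; apply/eqP => w0.
have [e [be He]] := orthonormal_basis_exists ip U.
have : gram ip e (vbasis U) != 0.
  apply: gram_basis_neq0; rewrite ?(basis_free (vbasisP U)) //.
  by rewrite (span_basis be) (span_basis (vbasisP U)).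
by rewrite -ext_inner_wedge w0 ext_inner0r eqxx.
Qed.

Definition grassmann_line U : projective (extalg X) :=
  exist _ (extpow (\dim U) U) (dim_extpow_dim U).

Lemma grassmann_lineP U V : (U <= V)%VS -> full_grassmannian V (grassmann_line U).
Proof. by move=> UV; exists U. Qed.

Lemma fubini_study_dim U U' (l m : projective (extalg X)) :
  val l = extpow (\dim U) U -> val m = extpow (\dim U') U' ->
  \dim U != \dim U' -> fubini_study ip l m = pi / 2.
Proof.
move=> lU mU UU.
have [e [be He]] := orthonormal_basis_exists ip U.
have [e' [be' He']] := orthonormal_basis_exists ip U'.
rewrite (fubini_studyE lU mU He (span_basis be) He' (span_basis be')).
rewrite gram_size ?normr0 -?(of_real0 R k) ?of_realK ?acos0 //.
by rewrite -(eqP (basis_free be)) -(eqP (basis_free be')) (span_basis be) (span_basis be').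
Qed.

(** The minimum is attained at the span of the principal vectors of W paired
    with U, and Hadamard's inequality bounds |gram e g| for every other subspace
    of W.  For dim U > dim W every distance is pi/2. *)
Lemma dist_to_grassmannian U W (l : projective (extalg X)) :
  val l = extpow (\dim U) U ->
  is_dist_to (fubini_study ip) l (full_grassmannian W) (grassmann_angle ip U W).
Proof.
move=> lU; have [WU|UW] := ltnP (\dim W) (\dim U).
  rewrite grassmann_angle_gt //.
  have allpi m : full_grassmannian W m -> fubini_study ip l m = pi / 2.
    move=> [U' UW' mU]; apply: fubini_study_dim lU mU _.
    by rewrite gtn_eqF // (leq_ltn_trans (dimvS UW')).
  split; last by move=> _ [m /allpi -> <-].
  by exists (grassmann_line W); [exact: grassmann_lineP | apply/allpi/grassmann_lineP].
have [theta [thetaP ->]] := grassmann_angle_le UW.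
have [e [f [[He eU] [Hf sf] fW ef]]] := principal_gram UW thetaP.
have /andP[P0 P1] := prod_cos_bound thetaP.
set P := \prod_(t <- theta) cos t in ef P0 P1 *.
have normP : to_real `|of_real P : F| = P.
  by rewrite ger0_norm ?of_realK // -(of_real0 R k) ler_of_real.
split.
  exists (grassmann_line <<f>>); first exact: grassmann_lineP.
  rewrite (@fubini_studyE _ _ _ ip U <<f>> e f l) //.
  have := ef [::] f; rewrite !cats0 gram_orthonormal // mulr1 => -> //.
    by rewrite normP.
  by apply/span_subvP.
move=> _ [m [U' UW' mU] <-].
have [g [bg Hg]] := orthonormal_basis_exists ip U'.
rewrite (fubini_studyE lU mU He eU Hg (span_basis bg)).
apply: acos_anti => //; first exact: to_real_norm_ge0.
have := ef [::] g; rewrite !cats0 => ->; last first.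
  by apply/span_subvP; rewrite (span_basis bg).
rewrite to_real_normM normP ler_piMr // -(@ler_of_real R k) to_realK // of_real1.
apply: gram_Hadamard => // x xf.
by have [_ ->] := orthonormal_memP _ _ Hf; rewrite // eqxx.
Qed.

Lemma grassmann_angle_mono U V W : (U <= V)%VS ->
  grassmann_angle ip U W <= grassmann_angle ip V W.
Proof.
move=> UV; have [WV|VW] := ltnP (\dim W) (\dim V).
  rewrite [leRHS]grassmann_angle_gt //; have [WU|UW] := ltnP (\dim W) (\dim U).
    by rewrite grassmann_angle_gt.
  have [theta [thetaP ->]] := grassmann_angle_le UW.
  by have /andP[P0 P1] := prod_cos_bound thetaP; have /andP[] := acos_pihalf P0 P1.
have [tV [tVP ->]] := grassmann_angle_le VW.
have [tU [tUP ->]] := grassmann_angle_le (leq_trans (dimvS UV) VW).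
have /andP[V0 V1] := prod_cos_bound tVP; have /andP[U0 U1] := prod_cos_bound tUP.
by apply: acos_anti => //; exact: prod_cos_mono tUP tVP.
Qed.

End Final.

Theorem proposition4p14 (R : realType) (k : ground)
    (X : vectType (ground_field R k)) (ip : {dot X for sconj}) (V W : {vspace X}) :
  is_directed_hausdorff (fubini_study ip)
    (full_grassmannian V) (full_grassmannian W) (grassmann_angle ip V W).
Proof.
split; first by move=> l [U _ lU]; exists (grassmann_angle ip U W); exact: dist_to_grassmannian.
split.
  exists (grassmann_line ip V); first exact: grassmann_lineP.
  exact: dist_to_grassmannian.
move=> r [l [U UV lU] [rin rmin]].
have [ain amin] := dist_to_grassmannian ip W lU.
by rewrite (le_trans (rmin _ ain)) // grassmann_angle_mono.
Qed.
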